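(* Let $d$ be a positive integer and $\epsilon>0$. Suppose $d/n \leq \delta \leq 1$, $H$ is a $d$-degenerate bipartite graph with $n$ vertices and maximum degree $\Delta \geq 1$, and $G$ is a graph with $N$ vertices and at least $\epsilon\binom{N}{2}$ edges, where $N \geq 2^{12}\epsilon^{-(1/\delta+3)d-2}\Delta^{\delta}n$. Then $H$ is a subgraph of $G$.
   Context: A graph is $d$-degenerate if every subgraph of it has a vertex of degree at most $d$. All graphs are finite and simple; ''subgraph'' means not necessarily induced.
   Formalization: The formal statement adds N ≥ 2; without it the claim fails, e.g. d=1, H=K_2 (n=2, Δ=1), δ=1, ε=1000, G a single vertex (N=1, zero edges, binom(1,2)=0). No case where the claim holds is lost, since Δ ≥ 1 forces n ≥ 2. *)

(* Defs.v *)
From mathcomp Require Import all_boot.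

Set Implicit Arguments.
Unset Strict Implicit.
Unset Printing Implicit Defensive.

Record sgraph := SGraph {
  vertex :> finType;
  edge : rel vertex;
  edge_sym : symmetric edge;
  edge_irr : irreflexive edge }.

Arguments edge {s} x y : rename.

Definition deg (G : sgraph) (x : G) : nat := #|[set y : G | edge x y]|.

Definition max_deg (G : sgraph) : nat := \max_(x : G) deg x.

Definition edges (G : sgraph) : {set {set G}} :=
  [set [set p.1; p.2] | p : G * G & edge p.1 p.2].

(* As usual, "K is a subgraph of G" is understood up to isomorphism: K has a
   (not necessarily induced) copy in G. *)
Definition subgraph (K G : sgraph) : Prop :=
  exists f : K -> G,
    injective f /\ forall x y : K, edge x y -> edge (f x) (f y).

(* The graph with no vertex is excluded: it has no vertex of any degree. *)
Definition degenerate (d : nat) (G : sgraph) : Prop :=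
  forall K : sgraph, subgraph K G -> 0 < #|K| -> exists x : K, deg x <= d.

Definition independent (G : sgraph) (A : {set G}) : Prop :=
  forall x y : G, x \in A -> y \in A -> ~~ edge x y.

Definition bipartite (G : sgraph) : Prop :=
  exists A : {set G}, independent A /\ independent (~: A).

(* Main.v *)
Require Import Defs.
From mathcomp Require Import all_boot all_order all_algebra.
From mathcomp Require Import reals exp.
From mathcomp Require Import ring lra zify.

(**
Dependent random choice, applied twice.  Put [c ~ d / delta] and [t = c + d],
pick [t] random vertices of [G] and let [A] be their common neighbourhood, then
pick [t] random vertices of [A] and let [B] be theirs.  A [d]-tuple [S] of [A]
with few common neighbours in [B] yields a [(d + t)]-tuple of [A] with few common
neighbours in [G], which is unlikely by the choice of [A]; a [d]-tuple with few
common neighbours in [A] is unlikely to lie in [B].  Hence for some choice both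
[A] and [B] contain fewer than [(n / Delta) ^ d] tuples of size [d] with fewer
than [2 n] common neighbours in the other set.

Then [H] is embedded greedily along a degenerate order, one colour class into [A]
and the other into [B].  The images of the embedded neighbours of each vertex
still to come are kept "not bad": fewer than [n / Delta] vertices extend them to
a bad tuple.  Placing a vertex must avoid at most [Delta] sets of size less than
[n / Delta] and fewer than [n] used vertices, out of at least [2 n] candidates.
*)

Set Implicit Arguments.
Unset Strict Implicit.
Unset Printing Implicit Defensive.

Import Order.TTheory GRing.Theory Num.Theory.

(** * Greedy embedding *)

Section CommonNeighbours.

Variable G : sgraph.
Implicit Types (A B : {set G}) (s : seq G).

Definition common_nbrs s : {set G} := [set v | all (edge v) s].

Lemma common_nbrs_cons w s :
  common_nbrs (w :: s) = [set v | edge v w] :&: common_nbrs s.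
Proof. by apply/setP=> v; rewrite !inE. Qed.

Lemma all_common_nbrsC s1 s2 :
  all [in common_nbrs s1] s2 = all [in common_nbrs s2] s1.
Proof.
apply/allP/allP => h u us; rewrite inE; apply/allP => v vs;
  by move: (h v vs); rewrite inE => /allP/(_ u us); rewrite edge_sym.
Qed.

Definition few_common B (x : nat) s : bool := #|common_nbrs s :&: B| < x.

Definition few_common_tuples k A B (x : nat) : {set k.-tuple G} :=
  [set S : k.-tuple G | all [in A] S && few_common B x S].

End CommonNeighbours.

Lemma big_tuple_all_cons (R : Type) (idx : R) (op : Monoid.com_law idx)
    (T : finType) (A : {set T}) (k : nat) (F : seq T -> R) :
  \big[op/idx]_(S : k.+1.-tuple T | all [in A] S) F S =
  \big[op/idx]_(w in A) \big[op/idx]_(S : k.-tuple T | all [in A] S) F (w :: S).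
Proof.
rewrite pair_big_dep /=.
rewrite (reindex (fun p : T * k.-tuple T => cons_tuple p.1 p.2)) /=; last first.
  exists (fun S => (thead S, behead_tuple S)) => [[w S] _ | S _] /=.
    by congr pair; apply: val_inj.
  by rewrite [RHS]tuple_eta; apply: val_inj.
exact: eq_bigl.
Qed.

Lemma card_tuple_all (T : finType) (A : {set T}) k :
  #|[set S : k.-tuple T | all [in A] S]| = #|A| ^ k.
Proof.
elim: k => [|k IHk].
  rewrite expn0 -(cards1 [tuple of [::] : seq T]); apply: eq_card => S.
  by rewrite !inE (tuple0 S) eqxx.
rewrite -sum1_card; under eq_bigl do rewrite inE.
rewrite (@big_tuple_all_cons _ _ _ _ A k (fun=> 1)) expnS -IHk -sum_nat_const.
by apply: eq_bigr => w _; rewrite -sum1_card; apply: eq_bigl => S; rewrite inE.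
Qed.

(** * Bad sequences: those with too many bad extensions *)

Section Bad.

Variables (G : sgraph) (A B : {set G}) (n D x : nat).

(* [k] is the number of vertices still to be added to [s]; the threshold is
   [n / D] bad extensions, cleared of the division. *)
Fixpoint bad k (s : seq G) : bool :=
  if k is k'.+1 then n <= D * #|[set w in A | bad k' (w :: s)]|
  else few_common B x s.

(** A bad sequence has at least [n / D] bad one-vertex extensions in [A], each with at least
    [(n / D) ^ k] bad completions by induction; the powers of [D] are moved to the right. *)
Lemma bad_count k s : bad k s ->
  n ^ k <= D ^ k * #|[set S : k.-tuple G | all [in A] S & few_common B x (S ++ s)]|.
Proof.
elim: k s => [|k IHk] s.
  move=> /= bs; rewrite !expn0 mul1n card_gt0.
  by apply/set0Pn; exists [tuple]; rewrite inE.
move=> /= bs; rewrite !expnS.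
pose F S := nat_of_bool (few_common B x (S ++ s)).
have -> : #|[set S : k.+1.-tuple G | all [in A] S & few_common B x (S ++ s)]|
    = \sum_(S : k.+1.-tuple G | all [in A] S) F S.
  rewrite -sum1_card big_mkcond [RHS]big_mkcond; apply: eq_bigr => S _.
  by rewrite inE /F; case: (all _ _) => //=; case: few_common.
rewrite big_tuple_all_cons.
have lb w : w \in [set w in A | bad k (w :: s)] -> n ^ k <= D ^ k *
    \sum_(S : k.-tuple G | all [in A] S) F (w :: S).
  rewrite inE => /andP[_ /IHk]; congr (_ <= D ^ k * _).
  rewrite -sum1_card big_mkcond [RHS]big_mkcond; apply: eq_bigr => S _.
  rewrite inE /F /few_common; case: (all _ _) => //=.
  (* Common neighbours do not depend on the order of the sequence. *)
  have -> : common_nbrs (S ++ w :: s) = common_nbrs (w :: S ++ s).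
    by apply/setP=> v; rewrite !inE /= !all_cat /= andbCA.
  by case: (_ < _).
apply: (@leq_trans (D * #|[set w in A | bad k (w :: s)]| * n ^ k)).
  by rewrite leq_mul2r bs orbT.
rewrite -!mulnA leq_mul2l; apply/orP; right.
rewrite -sum_nat_const big_distrr /=.
apply: (@leq_trans (\sum_(w in [set w in A | bad k (w :: s)])
   D ^ k * \sum_(S : k.-tuple G | all [in A] S) F (w :: S))).
  exact: leq_sum.
rewrite [leqRHS](bigID (fun w => bad k (w :: s))) /=.
under eq_bigl do rewrite inE.
exact: leq_addr.
Qed.

(** Since [A] has at least [n / D] elements, some extension of [s] in [A] is again not bad. After
    [k] steps the full sequence has [x] common neighbours in [B], and these are also common
    neighbours of [s]. *)
Lemma not_bad_many_common k s : n <= D * #|A| -> ~~ bad k s ->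
  x <= #|common_nbrs s :&: B|.
Proof.
move=> nA; elim: k s => [|k IHk] s /=; first by rewrite /few_common -leqNgt.
rewrite -ltnNge => lt_n.
have /subsetPn[w wA] : ~~ (A \subset [set w in A | bad k (w :: s)]).
  apply: contraTN lt_n => /subset_leq_card sA; rewrite -leqNgt.
  by rewrite (leq_trans nA) // leq_mul2l sA orbT.
rewrite inE wA /= => /IHk/leq_trans; apply.
by rewrite subset_leq_card // common_nbrs_cons -setIA subsetIr.
Qed.

End Bad.

Lemma mem_split (T : eqType) (x : T) s :
  x \in s -> exists s1 s2, s = s1 ++ x :: s2.
Proof. by case/splitPr=> s1 s2; exists s1, s2. Qed.

(** * Degenerate orders of the vertices *)

Definition degenerate_order d (H : sgraph) (s : seq H) : Prop :=
  forall s1 v s2, s = s1 ++ v :: s2 -> count (edge v) s1 <= d.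

Section InducedSubgraph.

Variables (H : sgraph) (X : {set H}).

Definition induced_edge (u v : {u | u \in X}) := edge (val u) (val v).

Lemma induced_edge_sym : symmetric induced_edge.
Proof. by move=> u v; apply: edge_sym. Qed.

Lemma induced_edge_irr : irreflexive induced_edge.
Proof. by move=> u; apply: edge_irr. Qed.

Definition induced := SGraph induced_edge_sym induced_edge_irr.

Lemma induced_subgraph : subgraph induced H.
Proof. by exists val; split => //; apply: val_inj. Qed.

End InducedSubgraph.

(** Built from the end: a vertex of degree at most [d] in the subgraph induced on the remaining set
    [X] is placed last, and the rest is ordered by induction on the size of [X]. *)
Lemma degenerate_orderP d (H : sgraph) : degenerate d H ->
  exists s : seq H, [/\ uniq s, s =i H & degenerate_order d s].
Proof.
move=> degH.
suff [s [us sX ds]] : exists s : seq H,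
    [/\ uniq s, s =i [set: H] & degenerate_order d s].
  by exists s; split => // u; rewrite sX inE.
move: [set: H] => X.
elim: {X}#|X| {-2}X (erefl #|X|) => [|m IHm] X cX.
  exists [::]; split => //; first by move=> u; rewrite (cards0_eq cX) inE.
  by case.
have [|[v vX] dv] := degH _ (induced_subgraph X); first by rewrite card_sig cX.
have [|s [us sX ds]] := IHm (X :\ v).
  by move: (cardsD1 v X); rewrite vX cX => -[].
exists (rcons s v); split.
- by rewrite rcons_uniq us sX !inE eqxx.
- move=> u; rewrite mem_rcons in_cons sX !inE.
  by case: eqP => // ->.
move=> s1 w s2; case/lastP: s2 => [|s2 z].
  rewrite cats1 => /rcons_inj[<- <-].
  rewrite -size_filter -(card_uniqP _) ?filter_uniq //.
  apply: leq_trans dv; rewrite /deg -(card_imset _ val_inj).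
  apply/subset_leq_card/subsetP => u; rewrite mem_filter sX !inE.
  case/andP=> e /andP[_ uX]; apply/imsetP; exists (exist _ u uX) => //.
  by rewrite inE.
by rewrite -rcons_cons -rcons_cat => /rcons_inj[/ds].
Qed.

(** * Embedding one vertex at a time *)

Section Embedding.

Variables (H G : sgraph) (g0 : G) (d n D : nat) (side : H -> bool) (A : bool -> {set G}).
Hypothesis side_edge : forall u v : H, edge u v -> side v = ~~ side u.
Hypothesis cardH : #|H| = n.
Hypothesis degH : forall u : H, deg u <= D.
Hypothesis D_gt0 : 0 < D.
Hypothesis cardA : forall b, n <= D * #|A b|.

(** Sequences are extended in [A b] and their common neighbours sought in [A (~~ b)]. The threshold
    [2 n] exceeds the at most [n] forbidden vertices plus the fewer than [n] used ones. *)
Let badb b := bad (A b) (A (~~ b)) n D n.*2.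

Definition nbr_images (f : H -> G) (p : seq H) v := [seq f u | u <- p & edge v u].

(* [p] lists the vertices embedded so far, the last one first. *)
Definition partial_embedding (p q : seq H) (f : H -> G) : Prop :=
  [/\ {in p &, injective f},
      {in p &, forall u v, edge u v -> edge (f u) (f v)} &
      forall v, v \in q -> ~~ badb (~~ side v) (d - size (nbr_images f p v))
                                 (nbr_images f p v)].

Lemma extend_partial_embedding p v q f :
  uniq (p ++ v :: q) ->
  (forall u, u \in q -> count (edge u) (v :: p) <= d) ->
  partial_embedding p (v :: q) f ->
  exists f', partial_embedding (v :: p) q f'.
Proof.
move=> upq dq [injf homf goodf].
have vNp : v \notin p.
  by move: upq; rewrite cat_uniq /= negb_or => /and3P[_ /andP[]].
(* [W u] holds the images of [v] that would spoil a later neighbour [u]. *)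
pose W u := [set w in A (side v) |
  badb (side v) (d - (size (nbr_images f p u)).+1) (w :: nbr_images f p u)].
pose forbidden := \bigcup_(u in [set u in q | edge v u]) W u.
have cW u : u \in [set u in q | edge v u] -> D * #|W u| <= n.
  rewrite inE => /andP[uq vu].
  have := goodf u; rewrite in_cons uq orbT => /(_ isT).
  have := dq u uq; rewrite /= edge_sym vu -size_filter.
  rewrite -(size_map f) -/(nbr_images f p u) add1n => lt_d.
  rewrite (side_edge vu) negbK /badb.
  (* As [v] itself is among the at most [d] early neighbours of [u], fewer than [d] images were
     present, so the truncated subtraction is exact. *)
  have -> : d - size (nbr_images f p u) = (d - (size (nbr_images f p u)).+1).+1.
    lia.
  by rewrite /= -ltnNge => /ltnW.
have cforb : #|forbidden| <= n.
  rewrite -(leq_pmul2l D_gt0).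
  apply: (@leq_trans (D * \sum_(u in [set u in q | edge v u]) #|W u|)).
    rewrite leq_mul2l /forbidden; apply/orP; right.
    elim/big_rec2: _ => [|u m B _ le]; first by rewrite cards0.
    by rewrite cardsU (leq_trans (leq_subr _ _)) // leq_add2l.
  rewrite big_distrr /=.
  apply: (@leq_trans (\sum_(u in [set u in q | edge v u]) n)).
    exact: leq_sum.
  rewrite sum_nat_const leq_mul2r; apply/orP; right.
  apply: leq_trans (degH v); apply/subset_leq_card/subsetP => u.
  by rewrite !inE => /andP[].
have sp : size p < n.
  rewrite -cardH -(card_uniqP _) ?(cat_uniq p) //; last first.
    by move: upq; rewrite cat_uniq => /andP[].
  apply: proper_card; apply/properP; split; first exact/subsetP.
  by exists v.
have := goodf v; rewrite mem_head => /(_ isT)/not_bad_many_common.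
move=> /(_ (cardA _)); rewrite negbK => many.
have /subsetPn[w] : ~~ (common_nbrs (nbr_images f p v) :&: A (side v)
    \subset forbidden :|: [set w in map f p]).
  apply: contraTN many => /subset_leq_card le; rewrite -ltnNge.
  apply: leq_ltn_trans le _; rewrite cardsU; apply: leq_ltn_trans (leq_subr _ _) _.
  have : #|[set w in map f p]| <= size p.
    by rewrite cardsE -(size_map f); apply: card_size.
  lia.
rewrite in_setI => /andP[wN wA]; rewrite in_setU inE negb_or => /andP[wNf wNp].
pose f' u := if u == v then w else f u.
have f'v : f' v = w by rewrite /f' eqxx.
have f'p u : u \in p -> f' u = f u.
  by rewrite /f'; case: eqP => // ->; rewrite (negbTE vNp).
have wf u : u \in p -> w != f u.
  by move=> up; apply: contraNneq wNp => ->; apply: map_f.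
have im u : nbr_images f' p u = nbr_images f p u.
  by apply/eq_in_map => z; rewrite mem_filter => /andP[_ /f'p].
have we u : u \in p -> edge v u -> edge w (f u).
  move=> up vu; move: wN; rewrite inE => /allP; apply.
  by apply: map_f; rewrite mem_filter vu.
exists f'; split.
- move=> u1 u2; rewrite !in_cons => /predU1P[->|u1p] /predU1P[->|u2p] //.
  + by rewrite f'v f'p // => /eqP; rewrite (negbTE (wf _ _)).
  + by rewrite f'v f'p // => /esym/eqP; rewrite (negbTE (wf _ _)).
  + by rewrite !f'p //; apply: injf.
- move=> u1 u2; rewrite !in_cons => /predU1P[->|u1p] /predU1P[->|u2p].
  + by rewrite edge_irr.
  + by rewrite f'v f'p //; apply: we.
  + by rewrite f'v f'p // edge_sym [in X in _ -> X]edge_sym; apply: we.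
  + by rewrite !f'p //; apply: homf.
(* Only the sequences of later neighbours of [v] change; they stay good because [w] avoids
   [forbidden]. *)
move=> u uq; rewrite /nbr_images /=; case: ifP => [uv|_].
  rewrite /= f'v -/(nbr_images f' p u) im.
  apply: contraNN wNf => wbad; apply/bigcupP; exists u.
    by rewrite inE uq edge_sym.
  have suv : ~~ side u = side v by rewrite (side_edge uv).
  by rewrite inE wA /= -suv.
rewrite -/(nbr_images f' p u) im; apply: goodf.
by rewrite in_cons uq orbT.
Qed.

Lemma embed_degenerate : degenerate d H ->
  (forall b, D ^ d * #|few_common_tuples d (A b) (A (~~ b)) n.*2| < n ^ d) ->
  subgraph H G.
Proof.
move=> /degenerate_orderP[s [us sH ds]] few.
suff [f [injf homf _]] : exists f, partial_embedding (rev s) [::] f.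
  by exists f; split => [u v|u v]; [apply: injf | apply: homf];
    rewrite mem_rev sH.
(* If the empty sequence were bad, [bad_count] would give at least [(n / D) ^ d] bad tuples. *)
have good0 b : ~~ badb b d [::].
  apply: contraTN (few b) => /bad_count; rewrite -leqNgt; congr (_ <= _ * _).
  by apply: eq_card => S; rewrite !inE cats0.
suff extend q p : rev p ++ q = s ->
    (exists f, partial_embedding p q f) ->
    exists f, partial_embedding (rev s) [::] f.
  apply: (extend s [::]) => //.
  by exists (fun=> g0); split => // v _; rewrite subn0; apply: good0.
elim: q p => [|v q IHq] p.
  by rewrite cats0 => <-; rewrite revK.
move=> def_s [f emb]; apply: (IHq (v :: p)); first by rewrite rev_cons cat_rcons.
have early u q1 q2 : v :: q = q1 ++ u :: q2 -> count (edge u) (rev p ++ q1) <= d.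
  by move=> def_q; apply: (ds _ _ q2); rewrite -catA -def_q.
apply: extend_partial_embedding emb => [|u].
- rewrite -def_s cat_uniq in us; rewrite cat_uniq; move: us.
  by rewrite rev_uniq; under eq_has do rewrite mem_rev.
- case/mem_split=> q1 [q2 def_q]; have := early u (v :: q1) q2.
  rewrite def_q => /(_ erefl); rewrite count_cat count_rev /=.
  by apply: leq_trans; rewrite addnCA leq_add2l leq_addr.
Qed.

End Embedding.

Local Open Scope ring_scope.

(** * Dependent random choice *)

(** Convexity: the power function lies above its tangent at [m]. It serves both for power means and,
    at [m = 1], as Bernoulli's inequality. *)
Lemma tangent_le_expr (R : realFieldType) (a m : R) k : 0 <= a -> 0 <= m ->
  m ^+ k.+1 + k.+1%:R * m ^+ k * (a - m) <= a ^+ k.+1.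
Proof.
move=> a0 m0; elim: k => [|k IHk].
  by rewrite !expr1 expr0; lra.
apply: le_trans (_ : a * (m ^+ k.+1 + k.+1%:R * m ^+ k * (a - m)) <= _); last first.
  by rewrite [leRHS]exprS ler_wpM2l.
rewrite -subr_ge0.
have -> : a * (m ^+ k.+1 + k.+1%:R * m ^+ k * (a - m)) -
   (m ^+ k.+2 + k.+2%:R * m ^+ k.+1 * (a - m)) = k.+1%:R * m ^+ k * (a - m) ^+ 2.
  by rewrite !exprS -(natr1 k.+1); ring.
by rewrite mulr_ge0 ?sqr_ge0 // mulr_ge0 ?ler0n ?exprn_ge0.
Qed.

(** Summing the tangent bounds at [m], the linear terms contribute a nonnegative amount because the
    mean of [F] is at least [m]. *)
Lemma power_mean_le (R : realFieldType) (I : finType) (F : I -> R) (m : R) k :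
  (0 < k)%N -> 0 <= m -> (forall i, 0 <= F i) ->
  #|I|%:R * m <= \sum_i F i -> #|I|%:R * m ^+ k <= \sum_i F i ^+ k.
Proof.
case: k => // k _ m0 F0 le_m.
apply: le_trans (ler_sum _ (fun i _ => tangent_le_expr k (F0 i) m0)).
rewrite big_split /= sumr_const -[X in X + _]mulr_natl lerDl -mulr_sumr.
rewrite mulr_ge0 ?mulr_ge0 ?exprn_ge0 // big_split /= sumr_const -[X in _ + X]mulr_natl.
by rewrite mulrN subr_ge0.
Qed.

(** This replaces expectation: a random choice is a sum over all choices, and [i0] excludes the
    empty sum. *)
Lemma sum_ge0_witness (R : realDomainType) (I : finType) (P : pred I) (F : I -> R) i0 :
  P i0 -> 0 <= \sum_(i | P i) F i -> exists2 i, P i & 0 <= F i.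
Proof.
move=> Pi0.
have [/existsP[i /andP[Pi Fi]]|/existsPn nF] :=
  boolP [exists i, P i && (0 <= F i)].
  by exists i.
rewrite leNgt => /negP[].
have neg i : P i -> F i < 0.
  by move=> Pi; have := nF i; rewrite Pi /= -ltNge.
rewrite (bigD1 i0) //= -[ltRHS]addr0 ltr_leD ?neg //.
by apply: sumr_le0 => i /andP[/neg/ltW].
Qed.

Lemma cards_sum_bool (T : finType) (P : pred T) :
  #|[set u | P u]| = (\sum_u P u)%N.
Proof.
rewrite -sum1dep_card big_mkcond; apply: eq_bigr => u _.
by case: (P u).
Qed.

Lemma leq_sum_card (I : finType) (F : I -> nat) m :
  (forall i, F i <= m)%N -> (\sum_i F i <= #|I| * m)%N.
Proof. by move=> Fm; rewrite -sum_nat_const; apply: leq_sum => i _. Qed.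

(** * Double counting of tuples and their common neighbours *)

Section DoubleCounting.

Variable G : sgraph.
Implicit Types A B : {set G}.

Lemma sum_card_common_nbrs t :
  (\sum_(T : t.-tuple G) #|common_nbrs T| = \sum_(v : G) deg v ^ t)%N.
Proof.
rewrite /common_nbrs; under [LHS]eq_bigr do rewrite cards_sum_bool.
rewrite exchange_big /=; apply: eq_bigr => v _.
rewrite -card_tuple_all cards_sum_bool; apply: eq_bigr => T _.
by congr nat_of_bool; apply: eq_all => u; rewrite inE.
Qed.

Lemma sum_all_common_nbrs t A s :
  (\sum_(T : t.-tuple G | all [in A] T) (all [in common_nbrs T] s : bool)
   = #|common_nbrs s :&: A| ^ t)%N.
Proof.
rewrite -card_tuple_all cards_sum_bool big_mkcond; apply: eq_bigr => T _.
have -> : all [in common_nbrs s :&: A] T =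
    all [in A] T && all [in common_nbrs s] T.
  by rewrite -all_predI; apply: eq_all => u; rewrite /= inE andbC.
by rewrite all_common_nbrsC; case: (all [in A] T).
Qed.

Lemma few_common_exp B x t s :
  (few_common B x s * #|common_nbrs s :&: B| ^ t <= x ^ t)%N.
Proof.
rewrite /few_common; case: ltnP => [/ltnW lt_x|_]; rewrite ?mul0n // mul1n.
by case: t => // t; rewrite leq_exp2r.
Qed.

(** For a fixed [S] with few common neighbours in [A], the tuple [T] must consist of these, leaving
    at most [x ^ t] choices. *)
Lemma sum_few_common_outside d t A x :
  (\sum_(T : t.-tuple G | all [in A] T)
     #|few_common_tuples d (common_nbrs T) A x| <= #|G| ^ d * x ^ t)%N.
Proof.
rewrite /few_common_tuples; under eq_bigr do rewrite cards_sum_bool.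
rewrite exchange_big /= -card_tuple; apply: leq_sum_card => S.
apply: leq_trans (few_common_exp A x t S).
rewrite -sum_all_common_nbrs big_distrr /=; apply: leq_sum => T _.
by rewrite andbC; case: few_common; case: all.
Qed.

Definition few_common_pairs d t A x : nat :=
  \sum_(T : t.-tuple G | all [in A] T) #|few_common_tuples d A (common_nbrs T) x|.

(** Fix the second tuple [T2] and [S], together a [(d + t)]-tuple. The first tuple [T1] consists of
    common neighbours of both, of which there are fewer than [x] whenever the triple counts. *)
Lemma sum_few_common_pairs d t x :
  (\sum_(T : t.-tuple G) few_common_pairs d t (common_nbrs T) x
   <= #|G| ^ (d + t) * x ^ t)%N.
Proof.
pose P (T1 T2 : t.-tuple G) (S : d.-tuple G) : bool :=
  [&& all [in common_nbrs T1] T2, all [in common_nbrs T1] S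
    & few_common (common_nbrs T2) x S].
have -> : (\sum_(T : t.-tuple G) few_common_pairs d t (common_nbrs T) x =
    \sum_T2 \sum_S \sum_T1 P T1 T2 S)%N.
  rewrite [RHS](eq_bigr _ (fun _ _ => exchange_big _ _ _ _ _ _)) /=.
  rewrite [RHS]exchange_big /=; apply: eq_bigr => T1 _.
  rewrite /few_common_pairs big_mkcond; apply: eq_bigr => T2 _.
  rewrite cards_sum_bool /P; case: ifP => //= _.
  by rewrite big1.
rewrite addnC expnD -mulnA -!card_tuple.
apply: leq_sum_card => T2; apply: leq_sum_card => S.
apply: leq_trans (few_common_exp (common_nbrs T2) x t S).
rewrite -sum_all_common_nbrs big_distrr [leqRHS]big_mkcond /=; apply: leq_sum => T1 _.
rewrite /P all_common_nbrsC; case: ifP => //= _.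
by rewrite mulnb andbC.
Qed.

End DoubleCounting.

Lemma dependent_random_choice (R : realFieldType) (G : sgraph) (d t x : nat)
    (rho : R) :
  (0 < #|G|)%N -> (0 < t)%N -> (0 < x)%N -> 0 < rho ->
  rho * #|G|%:R ^+ 2 <= (\sum_(v : G) deg v)%:R ->
  exists A B : {set G},
    #|G|%:R ^+ t * rho ^+ (t * t) <= 2 * #|A|%:R ^+ t /\
    (#|few_common_tuples d A B x| + #|few_common_tuples d B A x|)%:R *
      (#|G|%:R ^+ t * rho ^+ (t * t)) <= 4 * (#|G|%:R ^+ d * x%:R ^+ t).
Proof.
move=> N0 t0 x0 rho0 hdeg; set N : R := #|G|%:R.
have N_gt0 : 0 < N by rewrite ltr0n.
set c := N ^+ t * _; set q := N ^+ d * _.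
have c_gt0 : 0 < c by rewrite mulr_gt0 ?exprn_gt0.
have q_gt0 : 0 < q by rewrite mulr_gt0 ?exprn_gt0 // ltr0n.
have [g0 _] : exists g0 : G, true by move/card_gt0P: N0 => [g0 _]; exists g0.
have card_t : #|{: t.-tuple G}|%:R = N ^+ t by rewrite card_tuple natrX.
(* Power means are used twice: on degrees, the average of [|A|] is at least [N * rho ^ t]; then the
   average of [|A| ^ t] is at least [c]. *)
have hP : N ^+ t * c <= \sum_(T : t.-tuple G) #|common_nbrs T|%:R ^+ t.
  have -> : N ^+ t * c = #|{: t.-tuple G}|%:R * (N * rho ^+ t) ^+ t.
    by rewrite card_t exprMn -exprM.
  apply: power_mean_le => //.
    by rewrite mulr_ge0 ?exprn_ge0 // ltW.
  rewrite -natr_sum sum_card_common_nbrs natr_sum card_t.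
  have -> : N ^+ t * (N * rho ^+ t) = #|G|%:R * (rho * N) ^+ t.
    by rewrite exprMn mulrCA [N ^+ t * _]mulrC.
  under eq_bigr do rewrite natrX.
  apply: power_mean_le => //; first by rewrite mulr_ge0 ?ltW.
  by rewrite -natr_sum mulrCA -expr2.
pose b (A : {set G}) : R := (few_common_pairs d t A x)%:R.
have hQ : \sum_(T : t.-tuple G) b (common_nbrs T) <= N ^+ t * q.
  rewrite -natr_sum /q mulrA -exprD [(t + d)%N]addnC /N -!natrX -natrM ler_nat.
  exact: sum_few_common_pairs.
(* One combined quantity, with mean at least [2 q c - c q - q c = 0], makes a single [T1] give both
   a large [A] ([c <= 2 a]) and few bad pairs ([c * b A <= 2 q a]). *)
have [|T1 _ hT1] := @sum_ge0_witness R _ predT (fun T : t.-tuple G =>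
    2 * q * #|common_nbrs T|%:R ^+ t - c * b (common_nbrs T) - q * c)
    (nseq_tuple t g0) isT.
  rewrite !big_split /= !sumrN sumr_const -!mulr_sumr.
  rewrite -[X in _ - X]mulr_natl card_t.
  have := ler_wpM2l (ltW q_gt0) hP; have := ler_wpM2l (ltW c_gt0) hQ.
  lra.
set A := common_nbrs T1 in hT1.
set a := #|A|%:R ^+ t in hT1.
have b_ge0 : 0 <= b A by rewrite ler0n.
have ca : c <= 2 * a.
  rewrite -(ler_pM2l q_gt0); have := mulr_ge0 (ltW c_gt0) b_ge0; lra.
have a_gt0 : 0 < a by lra.
have cb : c * b A <= 2 * q * a by have := mulr_gt0 q_gt0 c_gt0; lra.
have card_a : #|[set T : t.-tuple G | all [in A] T]|%:R = a.
  by rewrite card_tuple_all natrX.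
have [T0] : exists T0, T0 \in [set T : t.-tuple G | all [in A] T].
  by apply/card_gt0P; rewrite -(ltr0n R) card_a.
rewrite inE => allT0.
(* Summed over the [a] tuples of [A], the two counts cost at most [2 q a] and [c q <= 2 q a], hence
   the [4 q]. *)
have [|T allT hT] := @sum_ge0_witness R _ (fun T : t.-tuple G => all [in A] T)
    (fun T => 4 * q - c * (#|few_common_tuples d A (common_nbrs T) x| +
                          #|few_common_tuples d (common_nbrs T) A x|)%:R) T0 allT0.
  rewrite big_split /= sumrN -[X in _ - X]mulr_sumr -natr_sum big_split natrD /=.
  rewrite -/(few_common_pairs d t A x) -/(b A).
  rewrite -[X in X - _]big_set /= sumr_const -[X in X - _]mulr_natr card_a.
  have : (\sum_(T : t.-tuple G | all [in A] T)
     #|few_common_tuples d (common_nbrs T) A x|)%:R <= q.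
    rewrite /q /N -!natrX -natrM ler_nat; exact: sum_few_common_outside.
  move=> /(ler_wpM2l (ltW c_gt0)).
  have := ler_wpM2l (ltW q_gt0) ca.
  lra.
exists A, (common_nbrs T); split => //.
by rewrite mulrC -subr_ge0.
Qed.

(** * Choice of the parameters *)

(** Each edge, as a set, arises from two distinct ordered pairs. *)
Lemma card_edges_double_le (G : sgraph) :
  (2 * #|edges G| <= \sum_(v : G) deg v)%N.
Proof.
have -> : (\sum_(v : G) deg v = \sum_(p : G * G | edge p.1 p.2) 1)%N.
  rewrite -(pair_big_dep predT (fun u v : G => edge u v) (fun _ _ => 1)%N) /=.
  by apply: eq_bigr => u _; rewrite /deg -sum1dep_card.
rewrite (partition_big (fun p : G * G => [set p.1; p.2]) [in edges G]) /=; last first.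
  by move=> p ep; apply/imsetP; exists p; rewrite ?inE.
rewrite mulnC -sum_nat_const; apply: leq_sum => E /imsetP[[u v] /= ].
rewrite inE /= => euv ->.
have uv : (u, v) != (v, u).
  by apply: contraTneq euv => -[-> _]; rewrite edge_irr.
rewrite (bigD1 (u, v)) /= ?euv ?eqxx // (bigD1 (v, u)) //=.
by rewrite edge_sym euv setUC eqxx eq_sym uv.
Qed.

Lemma card_edges_le (G : sgraph) : (#|edges G| <= 'C(#|G|, 2))%N.
Proof.
rewrite -card_draws; apply/subset_leq_card/subsetP => E /imsetP[[u v] /=].
rewrite inE /= => euv ->; rewrite inE cards2.
by case: (eqVneq u v) euv => // ->; rewrite edge_irr.
Qed.

Lemma powR_neg_ge1 (R : realType) (a r : R) : 0 < a <= 1 -> r <= 0 -> 1 <= a `^ r.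
Proof. by move=> a01 r0; rewrite -[leLHS](powRr0 a) ger_powR. Qed.

Lemma powR_ge1 (R : realType) (a r : R) : 1 <= a -> 0 <= r -> 1 <= a `^ r.
Proof. by move=> a1 r0; rewrite -[leLHS](powRr0 a) ler_powR. Qed.

(** * The inequality that the parameters must satisfy *)

Section Numerics.

Variables (R : realType) (d n N Delta c : nat) (eps delta : R).
Hypothesis eps_gt0 : 0 < eps.
Hypothesis eps_le1 : eps <= 1.
Hypothesis delta_gt0 : 0 < delta.
Hypothesis delta_le1 : delta <= 1.
Hypothesis n_gt0 : (0 < n)%N.
Hypothesis delta_ge : d%:R <= delta * n%:R.
Hypothesis Delta_gt0 : (0 < Delta)%N.
Hypothesis c_gt0 : (0 < c)%N.
Hypothesis c_ge : d%:R / delta <= c%:R.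
Hypothesis c_le : c%:R <= d%:R / delta + 1.

Let ratio := 2 ^+ 12 * eps `^ (- (1 / delta + 3) * d%:R - 2) * Delta%:R `^ delta.

Hypothesis N_ge : ratio * n%:R <= N%:R.

Let d_le : d%:R <= delta * c%:R.
Proof. by rewrite mulrC -ler_pdivrMr. Qed.

Let exponent_le0 : - (1 / delta + 3) * d%:R - 2 <= 0.
Proof.
have : 0 <= (1 / delta) * d%:R by rewrite mulr_ge0 // divr_ge0 // ltW.
have : 0 <= d%:R :> R by [].
lra.
Qed.

Let ratio_ge : 2 ^+ 12 <= ratio.
Proof.
rewrite /ratio -mulrA ler_peMr ?exprn_ge0 //.
rewrite -[leLHS]mulr1; apply: ler_pM => //.
  by apply: powR_neg_ge1; rewrite ?eps_gt0.
by apply: powR_ge1; rewrite ?ler1n // ltW.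
Qed.

(* This is where the exponent of [eps] comes from:
   [(c + d)^2 / c = c + 2 d + d^2 / c], with [c] close to [d / delta]. *)
Let square_le : ((c + d) * (c + d))%:R <= ((1 / delta + 3) * d%:R + 2) * c%:R.
Proof.
rewrite natrM natrD.
have c0 : 0 <= c%:R :> R by [].
have d0 : 0 <= d%:R :> R by [].
have dc : d%:R <= c%:R :> R.
  apply: le_trans d_le _; rewrite ler_piMl //.
have h1 : d%:R * d%:R <= d%:R * c%:R :> R by rewrite ler_wpM2l.
have h2 := ler_wpM2r c0 c_le.
have -> : ((1 / delta + 3) * d%:R + 2) * c%:R =
  (d%:R / delta + 1) * c%:R + 3 * (d%:R * c%:R) + c%:R by ring.
lra.
Qed.

(** Here [delta * c >= d] yields the power of [Delta], and [square_le] makes the total exponent of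
    [eps] nonpositive, so that factor is at least 1. *)
Let ratio_pow :
  2 ^+ (12 * c) * Delta%:R ^+ d <= ratio ^+ c * eps ^+ ((c + d) * (c + d)).
Proof.
set t := (c + d)%N.
have hDelta : Delta%:R ^+ d <= (Delta%:R `^ delta) ^+ c.
  by rewrite -!powR_mulrn ?powR_ge0 // -powRrM ler_powR // ler1n.
have heps : 1 <= (eps `^ (- (1 / delta + 3) * d%:R - 2)) ^+ c * eps ^+ (t * t).
  rewrite -!powR_mulrn ?powR_ge0 ?(ltW eps_gt0) // -powRrM -powRD; last first.
    by rewrite (gt_eqF eps_gt0) implybT.
  rewrite powR_neg_ge1 ?eps_gt0 //.
  by have := square_le; rewrite -/t; lra.
have two0 : 0 < 2 ^+ 12 :> R by rewrite exprn_gt0.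
rewrite exprM /ratio; move: (2 ^+ 12) two0 => b b0.
rewrite !exprMn -!mulrA ler_pM2l ?exprn_gt0 // mulrCA -[leLHS]mulr1.
by apply: ler_pM; rewrite ?exprn_ge0.
Qed.

Lemma host_size_ge : (4096 * n <= N)%N.
Proof.
rewrite -(ler_nat R) natrM; apply: le_trans N_ge; rewrite ler_pM2r ?ltr0n //.
by apply: le_trans ratio_ge; rewrite -natrX ler_nat.
Qed.

(** Cancelling [N ^ d * n ^ d] leaves a comparison of [c]-th powers, where [ratio_pow] applies; the
    surplus [2 ^ (12 c)] absorbs the constants and the factor [1 - 1 / N]. *)
Lemma parameters_bound :
  4 * (N%:R ^+ d * n.*2%:R ^+ (c + d)) * Delta%:R ^+ d <
  n%:R ^+ d * (N%:R ^+ (c + d) * (eps * (1 - N%:R^-1)) ^+ ((c + d) * (c + d))) :> R.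
Proof.
set t := (c + d)%N.
have n0 : 0 < n%:R :> R by rewrite ltr0n.
have c1 : 1 <= c%:R :> R by rewrite ler1n.
have n1 : 1 <= n%:R :> R by rewrite ler1n.
have ratio0 : 0 < ratio by apply: lt_le_trans ratio_ge; rewrite exprn_gt0.
have N_ge' : 4096 * n%:R <= N%:R :> R by rewrite -natrM ler_nat host_size_ge.
have N0 : 0 < N%:R :> R by lra.
have dc : (d <= c)%N.
  by rewrite -(ler_nat R); apply: le_trans d_le _; rewrite ler_piMl.
have dn : d%:R <= n%:R :> R.
  by apply: le_trans delta_ge _; rewrite ler_piMl // ltW.
have cn : c%:R <= n%:R + 1 :> R.
  by apply: le_trans c_le _; rewrite lerD2r ler_pdivrMr // mulrC.
have tN : t%:R <= N%:R / 2 :> R by rewrite natrD; lra.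
(* By Bernoulli [u ^ t >= 1 - t / N >= 1 / 2], where [t <= 2 n + 1 <= N / 2]. *)
set u := 1 - N%:R^-1.
have u0 : 0 <= u.
  by rewrite subr_ge0 invf_le1 //; lra.
have ut : 2^-1 <= u ^+ t.
  have [k tk] : exists k, t = k.+1 by exists t.-1; rewrite prednK // addn_gt0 c_gt0.
  have := tangent_le_expr k u0 (@ler01 R); rewrite !expr1n mulr1 -tk.
  apply: le_trans; rewrite /u.
  have -> : 1 + t%:R * (1 - N%:R^-1 - 1) = 1 - t%:R / N%:R :> R by ring.
  have : t%:R / N%:R <= 2^-1 :> R by rewrite ler_pdivrMr // mulrC.
  lra.
have utt : (2 ^+ t)^-1 <= u ^+ (t * t).
  by rewrite exprM -exprVn; apply: lerXn2r; rewrite ?nnegrE ?exprn_ge0 ?invr_ge0.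
have main : n%:R ^+ c * (2 ^+ (12 * c) * Delta%:R ^+ d) <=
    N%:R ^+ c * eps ^+ (t * t).
  apply: (@le_trans _ _ (n%:R ^+ c * (ratio ^+ c * eps ^+ (t * t)))).
    by rewrite ler_pM2l ?exprn_gt0 //; apply: ratio_pow.
  rewrite mulrA -exprMn ler_wpM2r ?exprn_ge0 // ?(ltW eps_gt0) //.
  by apply: lerXn2r; rewrite 1?mulrC ?nnegrE // ltW // mulr_gt0.
(* The exponents satisfy [2 + 2 t <= 2 + 4 c < 12 c], as [d <= c]. *)
have two : 4 * 2 ^+ t < 2 ^+ (12 * c) * (2 ^+ t)^-1 :> R.
  rewrite ltr_pdivlMr ?exprn_gt0 // (_ : 4 = 2 ^+ 2); last by rewrite -natrX.
  rewrite -!exprD ltr_eXn2l ?ltr1n // /t.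
  by move: dc c_gt0; clear; lia.
pose Z : R := N%:R ^+ d * n%:R ^+ d.
pose Y : R := n%:R ^+ c * Delta%:R ^+ d.
have Z0 : 0 < Z by rewrite mulr_gt0 ?exprn_gt0.
have Y0 : 0 < Y by rewrite mulr_gt0 ?exprn_gt0 // ltr0n.
have -> : 4 * (N%:R ^+ d * n.*2%:R ^+ t) * Delta%:R ^+ d = Z * (Y * (4 * 2 ^+ t)).
  by rewrite -muln2 natrM exprMn exprD /Z /Y; ring.
have -> : n%:R ^+ d * (N%:R ^+ t * (eps * u) ^+ (t * t)) =
    Z * (N%:R ^+ c * eps ^+ (t * t) * u ^+ (t * t)).
  by rewrite exprMn [N%:R ^+ t]exprD /Z; ring.
rewrite ltr_pM2l //.
apply: (@lt_le_trans _ _ (Y * (2 ^+ (12 * c) * (2 ^+ t)^-1))); first by rewrite ltr_pM2l.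
apply: (@le_trans _ _ (n%:R ^+ c * (2 ^+ (12 * c) * Delta%:R ^+ d) * (2 ^+ t)^-1)).
  by rewrite /Y; rewrite le_eqVlt; apply/orP; left; apply/eqP; ring.
apply: ler_pM => //; last by rewrite invr_ge0 exprn_ge0.
by rewrite !mulr_ge0 ?exprn_ge0 // ltW.
Qed.

End Numerics.

(** * From the two random choices to the copy of [H] *)

Theorem theorem1p4 (R : realType) (d n N Delta : nat) (eps delta : R)
    (H G : sgraph) :
  (0 < d)%N ->
  0 < eps ->
  d%:R / n%:R <= delta -> delta <= 1 ->
  degenerate d H -> bipartite H ->
  #|H| = n -> max_deg H = Delta -> (1 <= Delta)%N ->
  #|G| = N ->
  (2 <= N)%N ->
  eps * 'C(N, 2)%:R <= #|edges G|%:R ->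
  2 ^+ 12 * eps `^ (- (1 / delta + 3) * d%:R - 2) * Delta%:R `^ delta * n%:R
    <= N%:R ->
  subgraph H G.
Proof.
move=> d_gt0 eps_gt0 delta_ge delta_le1 degen [S [indS indSC]] cardH maxH Delta_gt0
  cardG N_ge2 eps_le N_ge.
have n_gt0 : (0 < n)%N.
  rewrite -cardH lt0n; apply: contraTneq Delta_gt0 => /card0_eq H0.
  by rewrite -maxH /max_deg big_pred0.
have n0 : 0 < n%:R :> R by rewrite ltr0n.
have delta_gt0 : 0 < delta.
  by apply: lt_le_trans delta_ge; rewrite divr_gt0 // ltr0n.
have N0 : 0 < N%:R :> R by rewrite ltr0n ltnW.
have eps_le1 : eps <= 1.
  have C0 : 0 < 'C(N, 2)%:R :> R by rewrite ltr0n bin_gt0.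
  rewrite -(ler_pM2r C0) mul1r; apply: le_trans eps_le _.
  by rewrite ler_nat -cardG card_edges_le.
pose c := (Num.trunc (d%:R / delta)).+1.
have /andP[c_le /ltW c_ge] : (c.-1)%:R <= d%:R / delta < c%:R.
  by apply: truncn_itv; rewrite divr_ge0 // ltW.
have c_le1 : c%:R <= d%:R / delta + 1 by rewrite -[c]/(c.-1.+1) -natr1 lerD2r.
rewrite ler_pdivrMr // in delta_ge.
have := parameters_bound eps_gt0 eps_le1 delta_gt0 delta_le1 n_gt0 delta_ge
  Delta_gt0 (ltn0Sn _) c_ge c_le1 N_ge.
set t := (c + d)%N; set rho := eps * _; set K := N%:R ^+ t * _ => bound.
(* [rho = eps * (1 - 1 / N)] because [eps * 'C(N, 2)] edges give average degree at least
   [eps * (N - 1) = rho * N]. *)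
have rho0 : 0 < rho.
  by rewrite mulr_gt0 // subr_gt0 invf_lt1 // ltr1n.
have K0 : 0 < K by rewrite mulr_gt0 ?exprn_gt0.
have [| | | | |A [B [cardA few]]] := @dependent_random_choice R G d t n.*2 rho;
    rewrite ?cardG ?double_gt0 ?addn_gt0 ?(ltnW N_ge2) //.
  apply: le_trans (_ : (2 * #|edges G|)%:R <= _); last first.
    by rewrite ler_nat card_edges_double_le.
  rewrite natrM; apply: le_trans (ler_wpM2l (ler0n _ 2) eps_le).
  rewrite [leRHS]mulrCA -natrM -mul_bin_diag bin1 -subn1 /rho.
  rewrite natrM natrB ?(ltnW N_ge2) //.
  rewrite le_eqVlt; apply/orP; left; apply/eqP; field; exact: lt0r_neq0.
rewrite cardG -/K in cardA few.
have few_lt : (Delta ^ d * (#|few_common_tuples d A B n.*2| +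
    #|few_common_tuples d B A n.*2|) < n ^ d)%N.
  rewrite -(ltr_nat R) natrM !natrX -(ltr_pM2r K0); apply: le_lt_trans bound.
  by rewrite -mulrA [leRHS]mulrC ler_pM2l // exprn_gt0 // ltr0n.
have n_le_N : (n <= N)%N.
  apply: leq_trans (host_size_ge eps_gt0 eps_le1 delta_gt0 n_gt0 Delta_gt0 N_ge).
  exact: leq_pmull.
(* If [|A| < n], the lower bound on [|A| ^ t] would make [K] too small for [bound]. *)
have n_le_A : (n <= Delta * #|A|)%N.
  suff : (n <= #|A|)%N by move=> /leq_trans; apply; rewrite leq_pmull.
  rewrite leqNgt; apply/negP => lt_n.
  suff : n%:R ^+ d * K <= 4 * (N%:R ^+ d * n.*2%:R ^+ t) * Delta%:R ^+ d.
    by rewrite leNgt bound.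
  have Kx : K <= 4 * n.*2%:R ^+ t.
    apply: le_trans cardA _; apply: ler_pM; rewrite ?exprn_ge0 ?ler_nat //.
    by apply: lerXn2r; rewrite ?nnegrE // ler_nat -addnn ltnW // ltn_addr.
  apply: (@le_trans _ _ (N%:R ^+ d * (4 * n.*2%:R ^+ t))).
    apply: ler_pM => //; rewrite ?exprn_ge0 ?(ltW K0) //.
    by apply: lerXn2r; rewrite ?nnegrE ?ler_nat.
  rewrite mulrCA ler_peMr ?mulr_ge0 ?exprn_ge0 //.
  by rewrite exprn_ege1 // ler1n.
(* The empty sequence is not bad, so it has at least [2 n] common neighbours in [B]; hence
   [|B| >= 2 n]. *)
have n_le_B : (n <= Delta * #|B|)%N.
  have /(not_bad_many_common n_le_A) x_le : ~~ bad A B n Delta n.*2 d [::].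
    apply: contraTN few_lt => /bad_count; rewrite -leqNgt => /leq_trans; apply.
    rewrite leq_mul2l; apply/orP; right; apply: leq_trans (leq_addr _ _).
    by apply: subset_leq_card; apply/subsetP => T; rewrite !inE cats0.
  apply: leq_trans (leq_pmull _ Delta_gt0).
  apply: leq_trans (subset_leq_card (subsetIr (common_nbrs [::]) B)).
  by apply: leq_trans x_le; rewrite -addnn leq_addr.
have /card_gt0P[g0 _] : (0 < #|G|)%N by rewrite cardG ltnW.
apply: (@embed_degenerate H G g0 d n Delta [in S] (fun b => if b then A else B)) => //.
- move=> u v euv; move: (indS u v) (indSC u v); rewrite !inE euv.
  by case: (u \in S); case: (v \in S) => // h1 h2;
    [have := h1 isT isT | have := h2 isT isT].
- by move=> u; rewrite -maxH; apply: leq_bigmax.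
- by case.
- case=> /=; apply: leq_ltn_trans few_lt; rewrite leq_mul2l ?leq_addr ?leq_addl orbT //.
Qed.
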